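(* Let $\mathbf{D}_{ec}^\pm:\Omega^a\times\Omega^a\to\mathbb{R}^m$ be consistent and entropy conservative fluctuation fluxes for the pair $(\eta,q)$, that is, $\mathbf{D}_{ec}^\pm(\mathbf{u},\mathbf{u})=0$ for all $\mathbf{u}\in\Omega^a$ and $$\boldsymbol{\eta}'(\mathbf{u}^-)^\top\mathbf{D}_{ec}^-(\mathbf{u}^-,\mathbf{u}^+)+\boldsymbol{\eta}'(\mathbf{u}^+)^\top\mathbf{D}_{ec}^+(\mathbf{u}^-,\mathbf{u}^+)=q(\mathbf{u}^+)-q(\mathbf{u}^-)\quad\forall\,\mathbf{u}^\pm\in\Omega^a,$$ and set $\tilde{\mathbf{D}}(\mathbf{u}^-,\mathbf{u}^+):=\mathbf{D}_{ec}^-(\mathbf{u}^-,\mathbf{u}^+)-\mathbf{D}_{ec}^+(\mathbf{u}^+,\mathbf{u}^-)$. Let $\mathbf{D}^\pm:\Omega^a\times\Omega^a\to\mathbb{R}^m$ be consistent and entropy stable fluctuation fluxes, that is, $\mathbf{D}^\pm(\mathbf{u},\mathbf{u})=0$ for all $\mathbf{u}\in\Omega^a$ and $$\boldsymbol{\eta}'(\mathbf{u}^-)^\top\mathbf{D}^-(\mathbf{u}^-,\mathbf{u}^+)+\boldsymbol{\eta}'(\mathbf{u}^+)^\top\mathbf{D}^+(\mathbf{u}^-,\mathbf{u}^+)\ge q(\mathbf{u}^+)-q(\mathbf{u}^-)\quad\forall\,\mathbf{u}^\pm\in\Omega^a.$$ Then the semi-discrete DGSEM $$\frac{\omega_kh}{2}\frac{d\mathbf{U}_j^k}{dt}+\omega_k\sum_{l=0}^p\tilde{\mathbf{D}}(\mathbf{U}_j^k,\mathbf{U}_j^l)D_{kl}+\delta_{kp}\mathbf{D}^-(\mathbf{U}_j^p,\mathbf{U}_{j+1}^0)+\delta_{k0}\mathbf{D}^+(\mathbf{U}_{j-1}^p,\mathbf{U}_j^0)=0,\quad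 j\in\mathbb{Z},\ 0\le k\le p,\ t>0,$$ satisfies, for all $j\in\mathbb{Z}$ and $t>0$, the entropy inequality $$h\frac{d\langle\eta\rangle_j}{dt}+Q(\mathbf{U}_j^p,\mathbf{U}_{j+1}^0)-Q(\mathbf{U}_{j-1}^p,\mathbf{U}_j^0)\le0,\qquad \langle\eta\rangle_j=\sum_{k=0}^p\frac{\omega_k}{2}\eta(\mathbf{U}_j^k),$$ where $Q$ may be taken to be either $$Q(\mathbf{U}_j^p,\mathbf{U}_{j+1}^0)=q(\mathbf{U}_j^p)+\boldsymbol{\eta}'(\mathbf{U}_j^p)^\top\mathbf{D}^-(\mathbf{U}_j^p,\mathbf{U}_{j+1}^0)$$ or $$Q(\mathbf{U}_j^p,\mathbf{U}_{j+1}^0)=q(\mathbf{U}_{j+1}^0)-\boldsymbol{\eta}'(\mathbf{U}_{j+1}^0)^\top\mathbf{D}^+(\mathbf{U}_j^p,\mathbf{U}_{j+1}^0).$$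
   Context: Continuous problem: the strictly hyperbolic system $\partial_t\mathbf{u}+\mathbf{A}(\mathbf{u})\partial_x\mathbf{u}=0$ in one space dimension, with $\mathbf{u}(x,t)$ in the set of states $\Omega^a\subset\mathbb{R}^m$ and $\mathbf{A}:\Omega^a\to\mathbb{R}^{m\times m}$ smooth. It is endowed with a smooth entropy-entropy flux pair $(\eta,q)$: $\eta:\Omega^a\to\mathbb{R}$ is strictly convex and $\boldsymbol{\eta}'(\mathbf{u})^\top\mathbf{A}(\mathbf{u})=\mathbf{q}'(\mathbf{u})^\top$ for all $\mathbf{u}\in\Omega^a$, where $\boldsymbol{\eta}'$ and $\mathbf{q}'$ are the gradients of $\eta$ and $q$. Discretization: a uniform grid of $\mathbb{R}$ with cells $\kappa_j=[x_{j-1/2},x_{j+1/2}]$, $j\in\mathbb{Z}$, $x_{j+1/2}=jh$, $h>0$. Let $p\ge1$, let $-1=s_0<s_1<\dots<s_p=1$ be the Gauss-Lobatto nodes on $[-1,1]$, with quadrature weights $\omega_k>0$, $\sum_{k=0}^p\omega_k=2$, and let $\ell_0,\dots,\ell_p$ be the associated Lagrange polynomials of degree $p$, $\ell_k(s_l)=\delta_{kl}$ ($\delta$ is the Kronecker symbol). The difference matrix is $D_{kl}=\ell_l'(s_k)$, $0\le k,l\le p$. In $\kappa_j$ the numerical solution is the polynomial of degree at most $p$ whose value at the node $x_j^k=x_j+s_kh/2$ ($x_j$ the cell center) is the degree of freedom $\mathbf{U}_j^k(t)\in\Omega^a$. *)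

(* Defs.v *)
From HB Require Import structures.
From mathcomp Require Import all_boot all_order all_algebra.
From mathcomp Require Import all_classical all_reals all_analysis.

Set Implicit Arguments.
Unset Strict Implicit.
Unset Printing Implicit Defensive.

Import Order.TTheory GRing.Theory Num.Theory.
Import numFieldNormedType.Exports.

Local Open Scope classical_set_scope.
Local Open Scope ring_scope.

(* Functions on the set of states Omega are represented by total functions on
   'cV[R]_m; every condition below only concerns their values on Omega, or,
   for smoothness, on an open neighbourhood of Omega (Omega itself when it is
   open). *)

Definition dotv (R : realType) (m : nat) (u v : 'cV[R]_m) : R :=
  (u^T *m v) 0 0.

Definition gradient (R : realType) (m : nat) (f : 'cV[R]_m -> R)
    (u : 'cV[R]_m) : 'cV[R]_m :=
  \col_(i < m) 'D_(delta_mx i 0) f u.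

(* f is C^k on the open set O; W is R for scalar functions and 'M[R]_m for
   matrix-valued ones. *)
Fixpoint Ck_on (R : realType) (m : nat) (W : normedModType R) (k : nat)
    (O : set 'cV[R]_m) (f : 'cV[R]_m -> W) : Prop :=
  match k with
  | 0%N => forall u, O u -> {for u, continuous f}
  | k'.+1 => (forall u, O u -> differentiable f u) /\
             (forall v : 'cV[R]_m, Ck_on k' O ('D_v f))
  end.

Definition smooth_on (R : realType) (m : nat) (W : normedModType R)
    (Omega : set 'cV[R]_m) (f : 'cV[R]_m -> W) : Prop :=
  exists O : set 'cV[R]_m,
    [/\ open O, Omega `<=` O & forall k, Ck_on k O f].

(* Omega is not required to be convex: the inequality is only imposed on the
   segments contained in Omega, hence on all of them when Omega is convex. *)
Definition strictly_convex_on (R : realType) (m : nat)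
    (Omega : set 'cV[R]_m) (f : 'cV[R]_m -> R) : Prop :=
  forall u v : 'cV[R]_m, Omega u -> Omega v -> u != v ->
  (forall s : R, 0 <= s <= 1 -> Omega (s *: u + (1 - s) *: v)) ->
  forall s : R, 0 < s < 1 ->
  f (s *: u + (1 - s) *: v) < s * f u + (1 - s) * f v.

Definition strictly_hyperbolic (R : realType) (m : nat)
    (Omega : set 'cV[R]_m) (A : 'cV[R]_m -> 'M[R]_m) : Prop :=
  forall u, Omega u ->
  exists lambda : 'I_m -> R,
    injective lambda /\ forall i, eigenvalue (A u) (lambda i).

Definition entropy_pair (R : realType) (m : nat) (Omega : set 'cV[R]_m)
    (A : 'cV[R]_m -> 'M[R]_m) (eta q : 'cV[R]_m -> R) : Prop :=
  [/\ smooth_on Omega (eta : 'cV[R]_m -> R^o),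
      smooth_on Omega (q : 'cV[R]_m -> R^o),
      strictly_convex_on Omega eta &
      forall u, Omega u -> (gradient eta u)^T *m A u = (gradient q u)^T].

Definition legendre (R : realType) (n : nat) : {poly R} :=
  (2 ^+ n * n`!%:R)^-1 *: derivn n (('X^2 - 1) ^+ n).

Definition gauss_lobatto_nodes (R : realType) (p : nat) (s : 'I_p.+1 -> R)
    : Prop :=
  [/\ s ord0 = -1, s ord_max = 1,
      forall k l : 'I_p.+1, (k < l)%N -> s k < s l &
      forall k : 'I_p.+1, (0 < k < p)%N -> root (deriv (legendre R p)) (s k)].

Definition lagrange_poly (R : realType) (p : nat) (s : 'I_p.+1 -> R)
    (k : 'I_p.+1) : {poly R} :=
  \prod_(l < p.+1 | l != k) ((s k - s l)^-1 *: ('X - (s l)%:P)).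

(* Weights of the interpolatory quadrature rule on [-1, 1] at the nodes s;
   at the Gauss-Lobatto nodes they are positive and sum to 2. *)
Definition quad_weight (R : realType) (p : nat) (s : 'I_p.+1 -> R)
    (k : 'I_p.+1) : R :=
  (\int[lebesgue_measure]_(x in `[(-1 : R), 1]) (lagrange_poly s k).[x])%R.

Definition diff_matrix (R : realType) (p : nat) (s : 'I_p.+1 -> R)
    : 'M[R]_p.+1 :=
  \matrix_(k, l) (deriv (lagrange_poly s l)).[s k].

Definition consistent_flux (R : realType) (m : nat) (Omega : set 'cV[R]_m)
    (Dm Dp : 'cV[R]_m -> 'cV[R]_m -> 'cV[R]_m) : Prop :=
  forall u, Omega u -> Dm u u = 0 /\ Dp u u = 0.

Definition entropy_conservative (R : realType) (m : nat)
    (Omega : set 'cV[R]_m) (eta q : 'cV[R]_m -> R)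
    (Dm Dp : 'cV[R]_m -> 'cV[R]_m -> 'cV[R]_m) : Prop :=
  forall um up, Omega um -> Omega up ->
  dotv (gradient eta um) (Dm um up) + dotv (gradient eta up) (Dp um up)
    = q up - q um.

Definition entropy_stable (R : realType) (m : nat)
    (Omega : set 'cV[R]_m) (eta q : 'cV[R]_m -> R)
    (Dm Dp : 'cV[R]_m -> 'cV[R]_m -> 'cV[R]_m) : Prop :=
  forall um up, Omega um -> Omega up ->
  dotv (gradient eta um) (Dm um up) + dotv (gradient eta up) (Dp um up)
    >= q up - q um.

Definition volume_flux (R : realType) (m : nat)
    (Decm Decp : 'cV[R]_m -> 'cV[R]_m -> 'cV[R]_m) (um up : 'cV[R]_m)
    : 'cV[R]_m :=
  Decm um up - Decp up um.

(* U j k t is the degree of freedom U_j^k(t), i.e. the value at the node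
   x_j + s_k h / 2 of the piecewise polynomial numerical solution. *)
Definition dgsem_solution (R : realType) (m p : nat) (Omega : set 'cV[R]_m)
    (Decm Decp Dm Dp : 'cV[R]_m -> 'cV[R]_m -> 'cV[R]_m)
    (s : 'I_p.+1 -> R) (h : R) (U : int -> 'I_p.+1 -> R -> 'cV[R]_m) : Prop :=
  forall (j : int) (k : 'I_p.+1) (t : R), 0 < t ->
  [/\ Omega (U j k t), derivable (U j k) t 1 &
      (quad_weight s k * h / 2) *: derive1 (U j k) t
      + quad_weight s k *: \sum_(l < p.+1)
          diff_matrix s k l *: volume_flux Decm Decp (U j k t) (U j l t)
      + (k == ord_max)%:R *: Dm (U j ord_max t) (U (j + 1) ord0 t)
      + (k == ord0)%:R *: Dp (U (j - 1) ord_max t) (U j ord0 t) = 0].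

Definition mean_entropy (R : realType) (m p : nat) (eta : 'cV[R]_m -> R)
    (s : 'I_p.+1 -> R) (U : int -> 'I_p.+1 -> R -> 'cV[R]_m)
    (j : int) (t : R) : R :=
  \sum_(k < p.+1) quad_weight s k / 2 * eta (U j k t).

Definition entropy_flux_left (R : realType) (m : nat)
    (eta q : 'cV[R]_m -> R) (Dm : 'cV[R]_m -> 'cV[R]_m -> 'cV[R]_m)
    (um up : 'cV[R]_m) : R :=
  q um + dotv (gradient eta um) (Dm um up).

Definition entropy_flux_right (R : realType) (m : nat)
    (eta q : 'cV[R]_m -> R) (Dp : 'cV[R]_m -> 'cV[R]_m -> 'cV[R]_m)
    (um up : 'cV[R]_m) : R :=
  q up - dotv (gradient eta up) (Dp um up).

(* Derivability is part of the claim because derive1 is a total operator. *)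
Definition cell_entropy_inequality (R : realType) (m p : nat)
    (eta : 'cV[R]_m -> R) (Q : 'cV[R]_m -> 'cV[R]_m -> R)
    (s : 'I_p.+1 -> R) (h : R) (U : int -> 'I_p.+1 -> R -> 'cV[R]_m)
    (j : int) (t : R) : Prop :=
  derivable (mean_entropy eta s U j : R -> R^o) t 1 /\
  h * derive1 (mean_entropy eta s U j : R -> R^o) t
    + Q (U j ord_max t) (U (j + 1) ord0 t)
    - Q (U (j - 1) ord_max t) (U j ord0 t) <= 0.

(* Main.v *)
(* The (p+1)-point Gauss-Lobatto rule is exact in degree 2p - 1: modulo
   N = (X^2 - 1) L', where L is the Legendre polynomial of degree p, every such
   polynomial reduces to its interpolant at the nodes, and the quotient, of
   degree at most p - 2, times N integrates to zero by one integration by parts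
   and orthogonality of L to lower degrees.  Applied to (l_k l_l)',
   exactness gives the summation-by-parts identity
   w_k D_kl + w_l D_lk = delta_kp delta_lp - delta_k0 delta_l0.  Contracting the
   scheme with the entropy variables, this identity and entropy conservation
   collapse the volume terms to q(U^p) - q(U^0); entropy stability at one of the
   two interfaces then gives the inequality for each choice of Q. *)

Require Import Defs.
From HB Require Import structures.
From mathcomp Require Import all_boot all_order all_algebra.
From mathcomp Require Import all_classical all_reals all_analysis.
From mathcomp Require Import zify ring lra.
Import Order.TTheory GRing.Theory Num.Theory.
Import numFieldNormedType.Exports.
Local Open Scope classical_set_scope.
Local Open Scope ring_scope.

(** * Kronecker sums and iterated derivatives of polynomials *)

Lemma sum_kronecker {R : pzSemiRingType} {I : finType} (a : I) (v : I -> R) :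
  \sum_i (i == a)%:R * v i = v a.
Proof.
rewrite (bigD1 a) //= eqxx mul1r big1 ?addr0 // => i /negbTE->.
by rewrite mul0r.
Qed.

(** As long as [k < size f], the leading coefficient is multiplied by a falling factorial, nonzero
    in characteristic zero. *)
Lemma size_derivn {R : numDomainType} (k : nat) (f : {poly R}) :
  size (derivn k f) = (size f - k)%N.
Proof.
apply/eqP; rewrite eqn_leq; apply/andP; split.
  apply/leq_sizeP => i ki; rewrite coef_derivn nth_default ?mul0rn //.
  by rewrite -leq_subLR.
have [|fk] := leqP (size f) k; first by rewrite -subn_eq0 => /eqP->.
rewrite leqNgt; apply/negP => lt_size.
have : (derivn k f)`_(size f - k).-1 = 0.
  by rewrite nth_default // -ltnS prednK // subn_gt0.
rewrite coef_derivn -subn1 addnBA ?subn_gt0 // subnKC ?(ltnW fk) // subn1.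
move/eqP; rewrite mulrn_eq0 -lead_coefE lead_coef_eq0 -size_poly_eq0.
by rewrite (gtn_eqF (leq_ltn_trans _ fk)) // orbF -leqn0 leqNgt ffact_gt0 -ltnS
  (ltn_predK fk) fk.
Qed.

(** By the Leibniz rule each differentiation costs at most one factor [g]. For [g = X^2 - 1] this
    kills the boundary terms at -1 and 1 in the integrations by parts. *)
Lemma dvdp_derivn_exp {R : fieldType} (g : {poly R}) (n k : nat) :
  (k <= n)%N -> g ^+ (n - k) %| derivn k (g ^+ n).
Proof.
elim: k => [|k IHk] kn; first by rewrite subn0 derivn0 dvdpp.
have /dvdpP[r gr] := IHk (ltnW kn).
rewrite derivnS gr derivM deriv_exp subnS.
case: (n - k)%N (subn_gt0 k n) => [|d _]; first by rewrite kn.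
apply: dvdp_add; first by rewrite dvdp_mull // exprS dvdp_mull.
by rewrite dvdp_mull // -mulrnAl dvdp_mull.
Qed.

Lemma horner_derivn_exp {R : fieldType} (g : {poly R}) (x : R) (n k : nat) :
  root g x -> (k < n)%N -> (derivn k (g ^+ n)).[x] = 0.
Proof.
move=> /rootP gx kn; have /dvdpP[r ->] := dvdp_derivn_exp g n k (ltnW kn).
by rewrite hornerM horner_exp gx expr0n subn_eq0 leqNgt kn mulr0.
Qed.

(** * Integration of polynomials over [-1, 1] *)

Definition poly_int {R : realType} (f : {poly R}) : R :=
  (\int[lebesgue_measure]_(x in `[(-1 : R), 1]) f.[x])%R.

Lemma poly_int_deriv {R : realType} (f : {poly R}) :
  poly_int (deriv f) = f.[1] - f.[-1].
Proof.
rewrite /poly_int /Rintegral (@continuous_FTC2 _ _ (horner f)) //.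
- by apply/continuous_subspaceT => x; exact: continuous_horner.
- split=> [x _| |].
  + exact: derivable_horner.
  + by apply: cvg_at_right_filter; exact: continuous_horner.
  + by apply: cvg_at_left_filter; exact: continuous_horner.
- by move=> x _; rewrite derivE.
Qed.

(* The constant coefficient is [f`_0 / 0 = 0]. *)
Definition primitive {R : fieldType} (f : {poly R}) : {poly R} :=
  \poly_(i < (size f).+1) (f`_i.-1 / i%:R).

Lemma deriv_primitive {R : numFieldType} (f : {poly R}) :
  deriv (primitive f) = f.
Proof.
apply/polyP => i; rewrite coef_deriv coef_poly ltnS /= -[LHS]mulr_natr.
have [fi|fi] := ltnP i (size f); first by rewrite divfK // pnatr_eq0.
by rewrite mul0r nth_default.
Qed.

(** Both polynomials are derivatives of their primitives, so linearity reduces to that of evaluation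
    at the endpoints, with no integrability to check. *)
Lemma poly_int_linear {R : realType} : linear (@poly_int R : {poly R} -> R^o).
Proof.
move=> a f g; have := deriv_primitive f; have := deriv_primitive g.
set F := primitive f; set G := primitive g => <- <-.
by rewrite -derivZ -derivD !poly_int_deriv !hornerE /GRing.scale /=; ring.
Qed.

HB.instance Definition _ (R : realType) :=
  GRing.isLinear.Build R {poly R} R^o *:%R (@poly_int R) poly_int_linear.

Lemma poly_int_parts {R : realType} (f g : {poly R}) :
  poly_int (deriv f * g)
    = f.[1] * g.[1] - f.[-1] * g.[-1] - poly_int (f * deriv g).
Proof.
by rewrite -!hornerM -poly_int_deriv derivM raddfD /= addrK.
Qed.

(** * Orthogonality and degree of Legendre polynomials *)

Lemma poly_int_derivn_orthogonal {R : realType} (n k : nat) (r : {poly R}) :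
  (k <= n)%N -> (size r <= k)%N ->
  poly_int (derivn k (('X^2 - 1) ^+ n) * r) = 0.
Proof.
elim: k r => [|k IHk] r kn.
  by rewrite leqn0 size_poly_eq0 => /eqP->; rewrite mulr0 raddf0.
(* Integration by parts moves one derivative onto [r]: the boundary terms vanish since the remaining
   order [k] is below [n], and [deriv r] has size at most [k]. *)
move=> rk; rewrite derivnS poly_int_parts !horner_derivn_exp //.
- rewrite !mul0r subrr sub0r IHk ?oppr0 ?(ltnW kn) //.
  by rewrite -(derivn1 r) size_derivn leq_subLR.
- by rewrite /root !hornerE sqrrN expr1n subrr.
- by rewrite /root !hornerE expr1n subrr.
Qed.

Lemma legendre_orthogonal {R : realType} (n : nat) (r : {poly R}) :
  (size r <= n)%N -> poly_int (legendre R n * r) = 0.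
Proof.
by move=> rn; rewrite /legendre -scalerAl linearZ /= poly_int_derivn_orthogonal
  ?scaler0.
Qed.

(** Rodrigues' formula gives a nonzero multiple of the derivative of order [n.+1] of a polynomial of
    degree 2n, hence size 2n + 1 - (n + 1). *)
Lemma size_deriv_legendre {R : realType} (n : nat) :
  size (deriv (legendre R n)) = n.
Proof.
rewrite /legendre derivZ -derivnS size_scale.
  rewrite size_derivn -[n.+1]add1n subnDA subn1 size_exp.
  rewrite -(polyC1 R) size_XnsubC //.
  by rewrite /= mul2n -addnn addnK.
by rewrite invr_eq0 mulf_neq0 ?expf_neq0 ?pnatr_eq0 // -lt0n fact_gt0.
Qed.

(** * Lagrange interpolation at distinct nodes *)

Section Nodes.
Context {R : realType} {p : nat} (s : 'I_p.+1 -> R).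
Hypothesis s_inj : injective s.

Lemma horner_lagrange_poly (k l : 'I_p.+1) :
  (lagrange_poly s k).[s l] = (k == l)%:R.
Proof.
rewrite /lagrange_poly horner_prod; have [<-|kl] := eqVneq k l.
  apply: big1 => i ik; rewrite !hornerE mulVf // subr_eq0.
  by apply: contra_neq ik => /s_inj.
by rewrite (bigD1 l) 1?eq_sym //= !hornerE subrr mulr0 mul0r.
Qed.

Lemma size_lagrange_poly (k : 'I_p.+1) : (size (lagrange_poly s k) <= p.+1)%N.
Proof.
rewrite /lagrange_poly scaler_prod (leq_trans (size_scale_leq _ _)) //.
by rewrite (eq_bigl (mem (predC1 k))) // -big_enum size_prod_XsubC -cardE cardC1
  card_ord.
Qed.

(** The difference of the two sides has size at most [p.+1] and vanishes at [p.+1] distinct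
    nodes. *)
Lemma lagrange_interpolation (f : {poly R}) :
  (size f <= p.+1)%N -> f = \sum_(k < p.+1) f.[s k] *: lagrange_poly s k.
Proof.
move=> sf; apply/eqP; rewrite -subr_eq0; apply/eqP.
apply: (@roots_geq_poly_eq0 _ _ (codom s)).
- apply/allP => _ /codomP[l ->]; apply/rootP; rewrite hornerD hornerN.
  rewrite horner_sum (bigD1 l) //= hornerZ horner_lagrange_poly eqxx mulr1.
  rewrite big1 ?addr0 ?subrr // => k kl.
  by rewrite hornerZ horner_lagrange_poly (negbTE kl) mulr0.
- by rewrite map_inj_uniq ?enum_uniq.
- rewrite size_map -cardE card_ord (leq_trans (size_polyD _ _)) // geq_max sf.
  rewrite size_polyN; apply: (leq_trans (size_sum _ _ _)).
  apply/bigmax_leqP => k _.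
  exact: leq_trans (size_scale_leq _ _) (size_lagrange_poly k).
Qed.

(** The Lagrange polynomials sum to the constant 1, whose derivative vanishes. *)
Lemma diff_matrix_row_sum (k : 'I_p.+1) :
  \sum_(l < p.+1) diff_matrix s k l = 0.
Proof.
transitivity (deriv (\sum_(l < p.+1) lagrange_poly s l)).[s k].
  by rewrite raddf_sum horner_sum; apply: eq_bigr => l _; rewrite mxE.
have := lagrange_interpolation 1; rewrite size_poly1 => /(_ isT).
under eq_bigr do rewrite hornerC scale1r.
by move=> <-; rewrite -(polyC1 R) derivC horner0.
Qed.

End Nodes.

(** * Gauss-Lobatto quadrature and summation by parts *)

Section GaussLobatto.
Context {R : realType} {p : nat} (s : 'I_p.+1 -> R).
Hypothesis p_ge1 : (1 <= p)%N.
Hypothesis s_nodes : gauss_lobatto_nodes s.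

Lemma gauss_lobatto_nodes_inj : injective s.
Proof.
have [_ _ s_mono _] := s_nodes; move=> k l skl; apply: val_inj.
by case: (ltngtP k l) => // /s_mono; rewrite skl ltxx.
Qed.

Let node_poly : {poly R} := ('X^2 - 1) * deriv (legendre R p).

Let node_poly_root (k : 'I_p.+1) : node_poly.[s k] = 0.
Proof.
have [s0 sp _ sk] := s_nodes; rewrite hornerM !hornerE.
have [->|k0] := eqVneq k ord0; first by rewrite s0 sqrrN expr1n subrr mul0r.
have [->|kp] := eqVneq k ord_max; first by rewrite sp expr1n subrr mul0r.
rewrite (rootP (sk k _)) ?mulr0 // lt0n k0 /= ltn_neqAle kp.
by rewrite -ltnS ltn_ord.
Qed.

Let size_node_poly : size node_poly = p.+2.
Proof.
rewrite size_proper_mul -?(polyC1 R) ?size_XnsubC // ?size_deriv_legendre //.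
by rewrite mulf_neq0 // lead_coef_eq0 -size_poly_eq0 ?size_XnsubC
  ?size_deriv_legendre // -lt0n.
Qed.

Lemma gauss_lobatto_exact (f : {poly R}) : (size f <= p.*2)%N ->
  \sum_(k < p.+1) quad_weight s k * f.[s k] = poly_int f.
Proof.
move=> sf; have N0 : node_poly != 0 by rewrite -size_poly_eq0 size_node_poly.
have sr : (size (f %% node_poly)%R <= p.+1)%N.
  by rewrite -ltnS -size_node_poly ltn_modp.
(* The quotient has size at most p - 1, so its product with ['X^2 - 1] has a derivative of size at
   most p, orthogonal to L. *)
have -> : poly_int f = poly_int (f %% node_poly).
  rewrite {1}(divp_eq f node_poly) raddfD /= mulrC mulrAC.
  rewrite [_ * deriv _]mulrC poly_int_parts.
  rewrite legendre_orthogonal; last first.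
    rewrite -derivn1 size_derivn leq_subLR.
    rewrite (leq_trans (size_polyMleq _ _)) // -(polyC1 R) size_XnsubC //.
    by rewrite size_divp // size_node_poly /=; move: (size f) sf => n;
      lia.
  have vanish (x : R) : x ^+ 2 = 1 -> (('X^2 - 1) * (f %/ node_poly)).[x] = 0.
    move=> x1; rewrite hornerM hornerD hornerN hornerXn hornerC x1 subrr.
    exact: mul0r.
  by rewrite !vanish ?sqrrN ?expr1n // !mulr0 !subr0 add0r.
(* The remainder equals its interpolant and, [node_poly] vanishing at the nodes, takes the values of
   [f] there. *)
rewrite [in RHS](lagrange_interpolation s gauss_lobatto_nodes_inj _ sr).
rewrite raddf_sum; apply: eq_bigr => k _ /=; rewrite linearZ /= mulrC.
congr (_ * _); rewrite {1}(divp_eq f node_poly) hornerD hornerM.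
by rewrite node_poly_root mulr0 add0r.
Qed.

Lemma summation_by_parts (k l : 'I_p.+1) :
  quad_weight s k * diff_matrix s k l + quad_weight s l * diff_matrix s l k
  = ((k == ord_max) && (l == ord_max))%:R - ((k == ord0) && (l == ord0))%:R.
Proof.
have s_inj := gauss_lobatto_nodes_inj; have [s0 sp _ _] := s_nodes.
have e1 i : (lagrange_poly s i).[1] = (i == ord_max)%:R.
  by rewrite -(horner_lagrange_poly s s_inj) sp.
have e0 i : (lagrange_poly s i).[-1] = (i == ord0)%:R.
  by rewrite -(horner_lagrange_poly s s_inj) s0.
have := gauss_lobatto_exact (deriv (lagrange_poly s k * lagrange_poly s l)).
rewrite poly_int_deriv !hornerM !e1 !e0 -!natrM !mulnb => <-.
  (* At the node [s i] each Leibniz term carries a Kronecker symbol, so only [i = l] and [i = k]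
     survive. *)
  rewrite (eq_bigr (fun i => quad_weight s i * diff_matrix s i k * (l == i)%:R
     + quad_weight s i * diff_matrix s i l * (k == i)%:R)); last first.
    move=> i _; rewrite derivM hornerD !hornerM !horner_lagrange_poly // !mxE.
    by rewrite mulrDr !mulrA [_ * (k == i)%:R * _]mulrAC.
  rewrite [LHS]addrC big_split /= (bigD1 l) //= [X in _ = _ + X](bigD1 k) //=.
  rewrite !eqxx !mulr1 !big1 ?addr0 // => i; rewrite eq_sym => /negbTE->;
    by rewrite mulr0.
(* The product has size at most 2p + 1, so its derivative just meets the bound for exactness. *)
rewrite -derivn1 size_derivn leq_subLR (leq_trans (size_polyMleq _ _)) //.
have := leq_add (size_lagrange_poly s k) (size_lagrange_poly s l).
by move: (_ + _)%N => n; lia.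
Qed.

(** Summation by parts trades the column sum for a row sum of [diff_matrix], which is zero; only the
    boundary terms remain. *)
Lemma quad_weight_col_sum (l : 'I_p.+1) :
  \sum_(k < p.+1) quad_weight s k * diff_matrix s k l
  = (l == ord_max)%:R - (l == ord0)%:R.
Proof.
have s_inj := gauss_lobatto_nodes_inj.
have -> : \sum_(k < p.+1) quad_weight s k * diff_matrix s k l
  = \sum_(k < p.+1) (((k == ord_max) && (l == ord_max))%:R
     - ((k == ord0) && (l == ord0))%:R - quad_weight s l * diff_matrix s l k).
  by apply: eq_bigr => k _; rewrite -summation_by_parts addrK.
rewrite !sumrB -mulr_sumr diff_matrix_row_sum // mulr0 subr0.
have indicator (a : 'I_p.+1) (b : bool) :
    \sum_(k < p.+1) ((k == a) && b)%:R = b%:R :> R.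
  by under eq_bigr do rewrite -mulnb natrM; rewrite sum_kronecker.
by rewrite !indicator.
Qed.

End GaussLobatto.

(** * Telescoping of the volume terms *)

Section EntropyBalance.
Context {R : realType} {p : nat} (s : 'I_p.+1 -> R).
Hypothesis p_ge1 : (1 <= p)%N.
Hypothesis s_nodes : gauss_lobatto_nodes s.

(* Summation by parts turns the sum against [b l k] into one against [b k l]:
   the boundary terms only involve the diagonal of [b]. *)
Lemma volume_sum_telescope (a b : 'I_p.+1 -> 'I_p.+1 -> R) (v : 'I_p.+1 -> R) :
  (forall k, b k k = 0) -> (forall k l, a k l + b k l = v l - v k) ->
  \sum_(k < p.+1) \sum_(l < p.+1)
    quad_weight s k * diff_matrix s k l * (a k l - b l k)
  = v ord_max - v ord0.
Proof.
move=> bkk abv.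
pose w k l := quad_weight s k * diff_matrix s k l.
have swap : \sum_(k < p.+1) \sum_(l < p.+1) w k l * b l k
    = - \sum_(k < p.+1) \sum_(l < p.+1) w k l * b k l.
  rewrite exchange_big -sumrN; apply: eq_bigr => k _ /=.
  rewrite -sumrN; apply: eq_bigr => l _.
  have [->|kl] := eqVneq k l; first by rewrite bkk !mulr0 oppr0.
  apply/eqP; rewrite -addr_eq0 -mulrDl addrC summation_by_parts //.
  have bnd c : (k == c) && (l == c) = false.
    by apply/negbTE/andP => -[/eqP kc /eqP lc]; rewrite kc lc eqxx in kl.
  by rewrite !bnd subrr mul0r.
have -> : \sum_(k < p.+1) \sum_(l < p.+1) w k l * (a k l - b l k)
    = \sum_(k < p.+1) \sum_(l < p.+1) (w k l * v l - w k l * v k).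
  under eq_bigr do (under eq_bigr do rewrite mulrBr; rewrite sumrB).
  rewrite sumrB swap opprK -big_split; apply: eq_bigr => k _ /=.
  rewrite -big_split; apply: eq_bigr => l _ /=.
  by rewrite -mulrDr abv mulrBr.
have s_inj := gauss_lobatto_nodes_inj s s_nodes.
(* Row sums remove the part in [v k]; column sums then evaluate the part in [v l] at the two end
   nodes. *)
under eq_bigr => k _ do rewrite sumrB -mulr_suml -mulr_sumr
  (diff_matrix_row_sum s s_inj) mulr0 mul0r subr0.
rewrite exchange_big /=.
under eq_bigr => l _ do rewrite -mulr_suml (quad_weight_col_sum s p_ge1 s_nodes)
  mulrBl.
by rewrite sumrB !sum_kronecker.
Qed.

End EntropyBalance.

(** * Pairing with the gradient and the chain rule *)

Lemma dotv_is_linear {R : realType} {m : nat} (u : 'cV[R]_m) :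
  linear (dotv u : 'cV[R]_m -> R^o).
Proof. by move=> a v w; rewrite /dotv mulmxDr -scalemxAr !mxE. Qed.

HB.instance Definition _ (R : realType) (m : nat) (u : 'cV[R]_m) :=
  GRing.isLinear.Build R 'cV[R]_m R^o *:%R (dotv u) (dotv_is_linear u).

Lemma dotvD {R : realType} {m : nat} (u v w : 'cV[R]_m) :
  dotv u (v + w) = dotv u v + dotv u w.
Proof. exact: raddfD. Qed.

Lemma dotvZ {R : realType} {m : nat} (u : 'cV[R]_m) (a : R) (v : 'cV[R]_m) :
  dotv u (a *: v) = a * dotv u v.
Proof. exact: linearZ. Qed.

Lemma diff_gradient {R : realType} {m : nat} (f : 'cV[R]_m -> R)
    (u v : 'cV[R]_m) :
  differentiable (f : 'cV[R]_m -> R^o) u ->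
  'd (f : 'cV[R]_m -> R^o) u v = dotv (gradient f u) v.
Proof.
move=> df; rewrite {1}(matrix_sum_delta v) raddf_sum /dotv mxE.
apply: eq_bigr => i _ /=; rewrite big_ord1 linearZ /= !mxE deriveE //.
by rewrite /GRing.scale /= mulrC.
Qed.

Lemma is_derive_comp_gradient {R : realType} {m : nat} (f : 'cV[R]_m -> R)
    (V : R -> 'cV[R]_m) (t : R) :
  differentiable (f : 'cV[R]_m -> R^o) (V t) -> derivable V t 1 ->
  is_derive t 1 (f \o V : R -> R^o) (dotv (gradient f (V t)) (derive1 V t)).
Proof.
move=> df /derivable1_diffP dV.
have dfV : differentiable ((f : 'cV[R]_m -> R^o) \o V) t.
  exact: differentiable_comp.
apply: DeriveDef; first exact/derivable1_diffP.
by rewrite deriveE // diff_comp //= diff_gradient // derive1E deriveE.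
Qed.

Lemma smooth_on_differentiable {R : realType} {m : nat} {W : normedModType R}
    {Omega : set 'cV[R]_m} {f : 'cV[R]_m -> W} (u : 'cV[R]_m) :
  smooth_on Omega f -> Omega u -> differentiable f u.
Proof. by move=> [N [_ sON /(_ 1%N)[df _]]] /sON; exact: df. Qed.

(** * Entropy balance in one cell *)

Section CellBalance.
Context {R : realType} {m p : nat} {Omega : set 'cV[R]_m}.
Context {eta q : 'cV[R]_m -> R}.
Context {Decm Decp Dm Dp : 'cV[R]_m -> 'cV[R]_m -> 'cV[R]_m}.
Context {s : 'I_p.+1 -> R} {h : R} {U : int -> 'I_p.+1 -> R -> 'cV[R]_m}.
Hypothesis eta_smooth : smooth_on Omega (eta : 'cV[R]_m -> R^o).
Hypothesis p_ge1 : (1 <= p)%N.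
Hypothesis s_nodes : gauss_lobatto_nodes s.
Hypothesis Dec_cons : consistent_flux Omega Decm Decp.
Hypothesis Dec_ec : entropy_conservative Omega eta q Decm Decp.
Hypothesis U_sol : dgsem_solution Omega Decm Decp Dm Dp s h U.

Lemma is_derive_mean_entropy (j : int) (t : R) : 0 < t ->
  is_derive t 1 (mean_entropy eta s U j : R -> R^o)
    (\sum_(k < p.+1) quad_weight s k / 2
       * dotv (gradient eta (U j k t)) (derive1 (U j k) t)).
Proof.
move=> t0.
have -> : (mean_entropy eta s U j : R -> R^o)
    = \sum_(k < p.+1) (quad_weight s k / 2) \*: (eta \o U j k : R -> R^o).
  by apply/funext => x; rewrite fct_sumE.
apply: is_derive_sum => k; apply: is_deriveZ.
have [Ok dU _] := U_sol j k t t0.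
by apply: is_derive_comp_gradient => //; exact: smooth_on_differentiable Ok.
Qed.

Lemma volume_entropy_production (V : 'I_p.+1 -> 'cV[R]_m) :
  (forall k, Omega (V k)) ->
  \sum_(k < p.+1) quad_weight s k * dotv (gradient eta (V k))
    (\sum_(l < p.+1) diff_matrix s k l *: volume_flux Decm Decp (V k) (V l))
  = q (V ord_max) - q (V ord0).
Proof.
move=> OV.
(* The swapped arguments of [Decp] in [volume_flux] make the pairing with the gradient at [V k]
   equal to [a k l - b l k], while entropy conservation concerns [a k l + b k l]. *)
pose a k l := dotv (gradient eta (V k)) (Decm (V k) (V l)).
pose b k l := dotv (gradient eta (V l)) (Decp (V k) (V l)).
rewrite -(volume_sum_telescope s p_ge1 s_nodes a b (q \o V)).
- apply: eq_bigr => k _; rewrite raddf_sum mulr_sumr; apply: eq_bigr => l _ /=.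
  by rewrite dotvZ raddfB mulrA.
- by move=> k; rewrite /b; have [_ ->] := Dec_cons _ (OV k); rewrite raddf0.
- by move=> k l; rewrite /a /b Dec_ec.
Qed.

Lemma cell_entropy_balance (j : int) (t : R) : 0 < t ->
  h * derive1 (mean_entropy eta s U j : R -> R^o) t
  = q (U j ord0 t) - q (U j ord_max t)
    - dotv (gradient eta (U j ord_max t))
        (Dm (U j ord_max t) (U (j + 1) ord0 t))
    - dotv (gradient eta (U j ord0 t)) (Dp (U (j - 1) ord_max t) (U j ord0 t)).
Proof.
move=> t0; rewrite derive1E.
have [_ ->] := is_derive_mean_entropy j t t0.
pose g k := dotv (gradient eta (U j k t)).
pose fm := Dm (U j ord_max t) (U (j + 1) ord0 t).
pose fp := Dp (U (j - 1) ord_max t) (U j ord0 t).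
pose vol k := \sum_(l < p.+1)
  diff_matrix s k l *: volume_flux Decm Decp (U j k t) (U j l t).
have node k : h * (quad_weight s k / 2 * g k (derive1 (U j k) t))
    = - (quad_weight s k * g k (vol k)) - (k == ord_max)%:R * g k fm
      - (k == ord0)%:R * g k fp.
  have [_ _ /(congr1 (g k))] := U_sol j k t t0.
  rewrite -/(vol k) -/fm -/fp /g !dotvD !dotvZ raddf0 => node_eq0.
  (* The zero on the right is replaced by the contracted scheme, which is identically the difference
     of the two sides. *)
  by apply/eqP; rewrite -subr_eq0 -{}node_eq0; apply/eqP; ring.
rewrite mulr_sumr (eq_bigr _ (fun k _ => node k)) !sumrB sumrN.
rewrite volume_entropy_production; last by move=> k; have [] := U_sol j k t t0.
by rewrite opprB !sum_kronecker.
Qed.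

End CellBalance.

Theorem theorem3p1 (R : realType) (m p : nat)
    (Omega : set 'cV[R]_m) (A : 'cV[R]_m -> 'M[R]_m)
    (eta q : 'cV[R]_m -> R)
    (Decm Decp Dm Dp : 'cV[R]_m -> 'cV[R]_m -> 'cV[R]_m)
    (s : 'I_p.+1 -> R) (h : R)
    (U : int -> 'I_p.+1 -> R -> 'cV[R]_m)
    (A_smooth : smooth_on Omega A)
    (A_hyp : strictly_hyperbolic Omega A)
    (eta_q : entropy_pair Omega A eta q)
    (p_ge1 : (1 <= p)%N)
    (h_gt0 : 0 < h)
    (s_nodes : gauss_lobatto_nodes s)
    (Dec_cons : consistent_flux Omega Decm Decp)
    (Dec_ec : entropy_conservative Omega eta q Decm Decp)
    (D_cons : consistent_flux Omega Dm Dp)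
    (D_es : entropy_stable Omega eta q Dm Dp)
    (U_sol : dgsem_solution Omega Decm Decp Dm Dp s h U) :
  forall (j : int) (t : R), 0 < t ->
    cell_entropy_inequality eta (entropy_flux_left eta q Dm) s h U j t /\
    cell_entropy_inequality eta (entropy_flux_right eta q Dp) s h U j t.
Proof.
move=> j t t0; have [eta_smooth _ _ _] := eta_q.
have OU i k : Omega (U i k t) by have [] := U_sol i k t t0.
have balance := cell_entropy_balance eta_smooth p_ge1 s_nodes Dec_cons Dec_ec
  U_sol j t t0.
have [dmean _] := is_derive_mean_entropy eta_smooth U_sol j t t0.
have left_es := D_es _ _ (OU (j - 1) ord_max) (OU j ord0).
have right_es := D_es _ _ (OU j ord_max) (OU (j + 1) ord0).
(* For the left flux the terms at the right interface cancel and [left_es] concludes; for the right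
   flux the left interface cancels and [right_es] concludes. *)
split; split=> //; rewrite balance /entropy_flux_left /entropy_flux_right; lra.
Qed.
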